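(* Let $P\subset\mathbb{Z}^n$ be a polymatroid with ground set $[n]$ and rank function $f$. Then the coefficient of the term of degree $n$ in $\mathcal{J}_P(x,1)$ is $1$, and the coefficient of the term of degree $n$ in $\mathcal{J}_P(1,y)$ is $1$.
   Context: Let $n$ be a positive integer, $[n]=\{1,\dots,n\}$, and let $\mathbf{e}_1,\dots,\mathbf{e}_n$ be the canonical basis of $\mathbb{R}^n$. A (integer) polymatroid $P$ with ground set $[n]$ is given by its rank function $f:2^{[n]}\to\mathbb{Z}$, which satisfies $f(\emptyset)=0$ and submodularity: $f(I)+f(J)\ge f(I\cup J)+f(I\cap J)$ for all $I,J\subseteq[n]$. Its set of bases is $$PB=\Big\{\mathbf{a}\in\mathbb{Z}^n : \sum_{i\in I}a_i\le f(I)\text{ for all } I\subseteq[n],\ \sum_{i\in[n]}a_i=f([n])\Big\}.$$ For $\mathbf{a}\in PB$, an index $i\in[n]$ is internally active if $\mathbf{a}-\mathbf{e}_i+\mathbf{e}_j\notin PB$ for every $j<i$, and externally active if $\mathbf{a}+\mathbf{e}_i-\mathbf{e}_j\notin PB$ for every $j<i$. Let $Int(\mathbf{a})$ and $Ext(\mathbf{a})$ denote the sets of internally and externally active indices with respect to $\mathbf{a}$. The polymatroid Tutte polynomial is $$\mathcal{J}_P(x,y)=\sum_{\mathbf{a}\in PB}x^{oi(\mathbf{a})}y^{oe(\mathbf{a})}(x+y-1)^{ie(\mathbf{a})},$$ where $oi(\mathbf{a})=|Int(\mathbf{a})\setminus Ext(\mathbf{a})|$, $oe(\mathbf{a})=|Ext(\mathbf{a})\setminus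 Int(\mathbf{a})|$, $ie(\mathbf{a})=|Int(\mathbf{a})\cap Ext(\mathbf{a})|$. *)

(* Defs.v *)
From mathcomp Require Import classical_sets cardinality fsbigop.
From mathcomp Require Import all_boot all_order all_algebra.
From mathcomp Require Import zify.

Set Implicit Arguments.
Unset Strict Implicit.
Unset Printing Implicit Defensive.

Import Order.TTheory GRing.Theory Num.Theory.
Local Open Scope ring_scope.

(* The ground set {1, ..., n} is encoded as 'I_n = {0, ..., n - 1}, with its
   natural order. The rank function is not assumed to be monotone. *)
Record polymatroid (n : nat) := Polymatroid {
  rank : {set 'I_n} -> int;
  rank_set0 : rank set0 = 0;
  rank_submodular : forall I J : {set 'I_n},
    rank (I :|: J) + rank (I :&: J) <= rank I + rank J
}.

Section Tutte.
Context {n : nat}.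
Implicit Types (P : polymatroid n) (a : 'rV[int]_n) (i j : 'I_n).

Definition evec i : 'rV[int]_n := delta_mx 0 i.

Definition bases P : {pred 'rV[int]_n} :=
  [pred a : 'rV[int]_n |
    [forall I : {set 'I_n}, \sum_(i in I) a 0 i <= rank P I]
    && (\sum_i a 0 i == rank P [set: 'I_n]%SET)].

Definition int_act P a : {set 'I_n} :=
  [set i : 'I_n | [forall j : 'I_n,
    (j < i)%N ==> (a - evec i + evec j \notin bases P)]]%SET.

Definition ext_act P a : {set 'I_n} :=
  [set i : 'I_n | [forall j : 'I_n,
    (j < i)%N ==> (a + evec i - evec j \notin bases P)]]%SET.

Definition oi P a : nat := #|int_act P a :\: ext_act P a|.
Definition oe P a : nat := #|ext_act P a :\: int_act P a|.
Definition ie P a : nat := #|int_act P a :&: ext_act P a|.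

(* An element of Z[x, y] is a polynomial in x with coefficients in Z[y]:
   x is the outer indeterminate 'X and y is 'Y, notation for 'X%:P. *)
Definition tutte_term P a : {poly {poly int}} :=
  'X ^+ oi P a * 'Y ^+ oe P a * ('X + 'Y - 1) ^+ ie P a.

(* A sum of finite support over a set; [bases_finite] below shows that the set
   is always finite. *)
Definition tutte P : {poly {poly int}} :=
  \sum_(a \in [set` bases P]%classic) tutte_term P a.

(* Specializations at y = 1 and at x = 1; the latter evaluates the outer
   indeterminate, so its remaining variable 'X stands for y. *)
Definition tutte_x1 P : {poly int} := map_poly (horner_eval (1 : int)) (tutte P).
Definition tutte_1y P : {poly int} := (tutte P).[1%:P].

Lemma bases_finite P : finite_set [set` bases P]%classic.
Proof.
pose K := (\sum_(I : {set 'I_n}) absz (rank P I))%N.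
have leK I : (absz (rank P I) <= K)%N by rewrite /K (bigD1 I) //= leq_addr.
pose g (c : {ffun 'I_n -> 'I_(4 * K).+1}) : 'rV[int]_n :=
  \row_i ((c i : nat)%:Z - (2 * K)%:Z).
have fing : finite_set (g @` [set: {ffun 'I_n -> 'I_(4 * K).+1}])%classic.
  by apply: finite_image; exact: finite_finset.
apply: sub_finite_set fing => a /= /andP[/forallP aP /eqP aT].
have bnd i : - (2 * K)%:Z <= a 0 i <= (2 * K)%:Z.
  have h1 := aP [set i]%SET; rewrite big_set1 in h1.
  have h2 := aP [set~ i]%SET.
  have h3 : \sum_k a 0 k = a 0 i + \sum_(k in [set~ i]%SET) a 0 k.
    rewrite (bigD1 i) //=; congr (_ + _); apply: eq_bigl => k.
    by rewrite !inE.
  have key (t s r1 r2 r : int) : t <= r1 -> s <= r2 -> r = t + s ->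
      (absz r1 <= K)%N -> (absz r2 <= K)%N -> (absz r <= K)%N ->
      - (2 * K)%:Z <= t <= (2 * K)%:Z.
    by clearbody K; lia.
  exact: key h1 h2 (etrans (esym aT) h3) (leK _) (leK _) (leK _).
exists [ffun i => inord (absz (a 0 i + (2 * K)%:Z))] => //.
apply/rowP => i; rewrite mxE ffunE inordK; have := bnd i; lia.
Qed.

End Tutte.

(* Main.v *)
Require Import Defs.
From mathcomp Require Import finmap classical_sets cardinality fsbigop.
From mathcomp Require Import all_boot all_order all_algebra.
From mathcomp Require Import zify.

Set Implicit Arguments.
Unset Strict Implicit.
Unset Printing Implicit Defensive.

Import Order.TTheory GRing.Theory Num.Theory.
Local Open Scope ring_scope.

(** Setting y = 1 turns the summand of a base a into x^(oi + ie) = x^|Int a|, so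
    the coefficient of x^n counts the bases all of whose indices are internally
    active; likewise the coefficient of y^n in J(1, y) counts the bases all of
    whose indices are externally active.  Int a = [n] says that no unit of a can
    be moved to a smaller index inside PB, and Ext a = [n] that no unit can be
    moved to a larger one.  Both are the same condition for the natural order
    and for its reverse, so it suffices to show that for every total order on
    the ground set exactly one base admits no move of a unit downwards.

    Moving a unit from i to j leaves PB exactly when a tight set (a set where
    the inequality of PB is an equality) contains j but not i
    ([exchange_notin_bases]).  By submodularity tight sets are closed under
    unions and intersections, so if no unit can be moved downwards, every
    initial segment of the order is tight ([optimal_tight_prefix]).  The values
    on initial segments then determine a: each entry is the increment of the
    rank function along the order.  Conversely this greedy vector is a base
    ([greedy_base], again by submodularity), and its tight initial segments
    block every downward move. *)

(** * Tight sets *)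

Section Tight.
Context {n : nat}.
Implicit Types (P : polymatroid n) (a : 'rV[int]_n) (i j : 'I_n).
Implicit Types (I J : {set 'I_n}).

Definition tight P a I : bool := \sum_(i in I) a 0 i == rank P I.

Lemma basesP P a :
  reflect ((forall I, \sum_(i in I) a 0 i <= rank P I) /\ tight P a [set: 'I_n])
          (a \in bases P).
Proof.
have eT : \sum_(i in [set: 'I_n]%SET) a 0 i = \sum_i a 0 i.
  by apply: eq_bigl => i; rewrite inE.
by rewrite inE /tight eT; apply: (iffP andP) => -[/forallP].
Qed.

Lemma sum_setUI a I J :
  \sum_(i in I :|: J) a 0 i + \sum_(i in I :&: J) a 0 i =
  \sum_(i in I) a 0 i + \sum_(i in J) a 0 i.
Proof.
rewrite (big_setID I) /= setUK setDUl setDv set0U.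
by rewrite [X in _ = _ + X](big_setID I) /= [J :&: I]setIC -addrA [X in _ + X]addrC.
Qed.

(** The slack of the inequalities of PB is nonnegative and submodular, so the
    sets on which it vanishes form a lattice. *)
Lemma tightUI P a I J : a \in bases P -> tight P a I -> tight P a J ->
  tight P a (I :|: J) /\ tight P a (I :&: J).
Proof.
move=> /basesP[aP _] /eqP tI /eqP tJ; rewrite /tight.
have := sum_setUI a I J; have := rank_submodular P I J.
have := aP (I :|: J); have := aP (I :&: J); rewrite tI tJ; lia.
Qed.

Lemma tight0 P a : tight P a set0.
Proof. by rewrite /tight big_set0 rank_set0. Qed.

Lemma sum_exchange a i j I :
  \sum_(k in I) (a - evec i + evec j) 0 k =
  \sum_(k in I) a 0 k - (i \in I)%:R + (j \in I)%:R.
Proof.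
have sum_evec k : \sum_(l in I) evec k 0 l = (k \in I)%:R :> int.
  under eq_bigr do rewrite mxE eqxx /=.
  have [kI|kI] := boolP (k \in I).
    by rewrite (bigD1 k) //= eqxx big1 ?addr0 // => l /andP[_ /negPf ->].
  by rewrite big1 // => l lI; case: eqP => // lk; rewrite -lk lI in kI.
have entry k : (a - evec i + evec j) 0 k = a 0 k - evec i 0 k + evec j 0 k.
  by rewrite !mxE.
by rewrite (eq_bigr _ (fun k _ => entry k)) big_split sumrB !sum_evec.
Qed.

(** Adding 1 to one entry and removing 1 from another changes the sum over a set
    by at most 1, so over the integers only a tight set can be violated. *)
Lemma exchange_notin_bases P a i j : a \in bases P ->
  (a - evec i + evec j \notin bases P) <->
  (exists I, [/\ tight P a I, j \in I & i \notin I]).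
Proof.
move=> aB; have /basesP[aP aT] := aB; split => [abad|[I [/eqP tI jI /negPf iI]]].
  have [/existsP[I /and3P[]]|/existsPn noI] :=
    boolP [exists I, [&& tight P a I, j \in I & i \notin I]].
    by exists I.
  case/negP: abad; apply/basesP; split => [I|].
    have := noI I; have := aP I; rewrite sum_exchange /tight.
    by case: (j \in I); case: (i \in I) => /=; lia.
  by move: aT; rewrite /tight sum_exchange !inE subrK.
by apply/negP => /basesP[/(_ I)]; rewrite sum_exchange tI jI iI; lia.
Qed.

End Tight.

(** * The greedy base of a total order *)

Section Greedy.
Context {n : nat} (h : 'I_n -> nat).
Hypothesis h_inj : injective h.
Implicit Types (P : polymatroid n) (a : 'rV[int]_n) (i j k : 'I_n) (m : nat).

(** The order is carried by an injective key [h], so that the natural order of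
    the ground set and its reverse are both instances. *)
Definition prefix_set m : {set 'I_n} := [set j | (h j < m)%N]%SET.

Definition greedy P : 'rV[int]_n :=
  \row_k (rank P (prefix_set (h k).+1) - rank P (prefix_set (h k))).

Definition optimal P a : Prop :=
  forall i j, (h j < h i)%N -> a - evec i + evec j \notin bases P.

Lemma prefix_setS k : prefix_set (h k).+1 = k |: prefix_set (h k).
Proof.
apply/setP => j; rewrite !inE ltnS leq_eqVlt; congr (_ || _).
by apply/eqP/eqP => [/h_inj|->].
Qed.

Lemma sum_prefix_setS a k :
  \sum_(j in prefix_set (h k).+1) a 0 j =
  a 0 k + \sum_(j in prefix_set (h k)) a 0 j.
Proof. by rewrite prefix_setS big_setU1 // inE ltnn. Qed.

Lemma tight_prefix_greedyP P a :
  (forall m, tight P a (prefix_set m)) <-> a = greedy P.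
Proof.
split=> [tP|->].
  apply/rowP => k; rewrite mxE.
  by rewrite -(eqP (tP _)) -(eqP (tP (h k))) sum_prefix_setS addrK.
elim=> [|m IHm].
  have -> : prefix_set 0 = set0 by apply/setP => j; rewrite !inE.
  exact: tight0.
have [/existsP[k /eqP hk]|/existsPn noh] := boolP [exists k, h k == m].
  by rewrite -hk in IHm *; rewrite /tight sum_prefix_setS (eqP IHm) mxE subrK.
have -> // : prefix_set m.+1 = prefix_set m.
by apply/setP => j; rewrite !inE ltnS leq_eqVlt (negPf (noh j)).
Qed.

(** By submodularity the increment of the rank when the last element k of I is
    added to the whole initial segment below k is at most its increment when k
    is added to the part I minus k of that segment. *)
Lemma greedy_base P : greedy P \in bases P.
Proof.
have tG m : tight P (greedy P) (prefix_set m).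
  by move: m; apply/tight_prefix_greedyP.
apply/basesP; split=> [I|]; last first.
  have -> // : [set: 'I_n]%SET = prefix_set (\max_k h k).+1.
  by apply/setP => j; rewrite !inE ltnS leq_bigmax.
have [r] := ubnP #|I|; elim: r I => // r IHr I ltIr.
have [->|[k0 k0I]] := set_0Vmem I; first by rewrite big_set0 rank_set0.
case: (arg_maxnP h k0I) => k /= Ik kmaxG; have kI : k \in I by [].
have kmax j : j \in I -> (h j <= h k)%N by move/kmaxG.
have eI : I :&: prefix_set (h k) = I :\ k.
  apply/setP => j; rewrite !inE andbC.
  have [jI|] := boolP (j \in I); last by rewrite !andbF.
  by rewrite !andbT ltn_neqAle (kmax j jI) andbT (inj_eq h_inj).
have eU : I :|: prefix_set (h k) = prefix_set (h k).+1.
  rewrite prefix_setS; apply/setP => j; rewrite !inE.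
  have [jI|jI] := boolP (j \in I) => /=.
    by rewrite -(inj_eq h_inj) -leq_eqVlt (kmax j jI).
  by case: eqP => // jk; rewrite jk kI in jI.
have := rank_submodular P I (prefix_set (h k)).
rewrite eI eU (big_setD1 k kI) /= [greedy P 0 k]mxE.
have : (#|I :\ k| < r)%N by move: ltIr; rewrite (cardsD1 k I) kI.
by move/IHr; move: (bigop _ _ _) => s; lia.
Qed.

(** For j in the segment, the smallest tight set containing j lies in the
    segment, since each later i is excluded by some tight set.  The segment is
    the union of these sets. *)
Lemma optimal_tight_prefix P a m :
  a \in bases P -> optimal P a -> tight P a (prefix_set m).
Proof.
move=> aB aopt.
pose hull j := \bigcap_(I : {set 'I_n} | tight P a I && (j \in I)) I.
have hull_tight j : tight P a (hull j).
  apply: (big_ind (tight P a)); first by have /basesP[] := aB.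
    by move=> I J tI tJ; have [] := tightUI aB tI tJ.
  by move=> I /andP[].
have hull_le i j : i \in hull j -> (h i <= h j)%N.
  move=> ij; rewrite leqNgt; apply/negP => /aopt.
  move=> /(exchange_notin_bases _ _ aB)[I [tI jI /negP iI]]; apply: iI.
  by move/bigcapP: ij; apply; rewrite tI.
have -> : prefix_set m = \bigcup_(j in prefix_set m) hull j.
  apply/setP => i; apply/idP/bigcupP => [im|[j]].
    by exists i => //; apply/bigcapP => I /andP[].
  by rewrite !inE => jm /hull_le /leq_ltn_trans; apply.
apply: (big_ind (tight P a)) => //; first exact: tight0.
by move=> I J tI tJ; have [] := tightUI aB tI tJ.
Qed.

Lemma optimalP P a : a \in bases P -> optimal P a <-> a = greedy P.
Proof.
move=> aB; split=> [aopt|aG i j ltji].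
  by apply/tight_prefix_greedyP => m; apply: optimal_tight_prefix.
apply/(exchange_notin_bases _ _ aB); exists (prefix_set (h j).+1).
split; last by rewrite inE ltnS -ltnNge.
  by move/tight_prefix_greedyP: aG.
by rewrite inE.
Qed.

End Greedy.

(** * Counting fully active bases *)

Section Coefficients.
Context {n : nat}.
Implicit Types (P : polymatroid n) (a : 'rV[int]_n).

Lemma int_act_setTP P a :
  int_act P a = [set: 'I_n]%SET <-> optimal (@nat_of_ord n) P a.
Proof.
split=> [aT i j ltji|aopt].
  by have := in_setT i; rewrite -aT inE => /forallP/(_ j)/implyP; apply.
by apply/setP => i; rewrite !inE; apply/forallP => j; apply/implyP/aopt.
Qed.

Lemma ext_act_setTP P a :
  ext_act P a = [set: 'I_n]%SET <-> optimal (fun i => rev_ord i : nat) P a.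
Proof.
have rev_lt (i j : 'I_n) : (rev_ord i < rev_ord j)%N = (j < i)%N.
  by have := ltn_ord i; have := ltn_ord j; rewrite /=; lia.
split=> [aT j i|aopt].
  rewrite rev_lt => ltji; have := in_setT i; rewrite -aT inE.
  by move=> /forallP/(_ j)/implyP/(_ ltji); rewrite addrAC.
apply/setP => i; rewrite !inE; apply/forallP => j; apply/implyP => ltji.
by rewrite addrAC; apply: aopt; rewrite rev_lt.
Qed.

Lemma tutte_x1E P :
  tutte_x1 P =
    \sum_(a \in [set` bases P]%classic) ('X^#|int_act P a| : {poly int}).
Proof.
rewrite /tutte_x1 /tutte !(fsbig_finite _ _ (bases_finite P)) rmorph_sum /=.
apply: eq_bigr => a _; rewrite /tutte_term !rmorphM !rmorphXn /=.
rewrite rmorphB rmorphD /= rmorph1 map_polyX map_polyC /= /horner_eval hornerX.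
by rewrite addrK expr1n mulr1 -exprD addnC /oi /ie cardsID.
Qed.

Lemma tutte_1yE P :
  tutte_1y P =
    \sum_(a \in [set` bases P]%classic) ('X^#|ext_act P a| : {poly int}).
Proof.
rewrite /tutte_1y /tutte !(fsbig_finite _ _ (bases_finite P)) horner_sum.
apply: eq_bigr => a _; rewrite /tutte_term !hornerE /=.
rewrite expr1n mul1r addrAC subrr add0r -exprD addnC /oe /ie.
by rewrite [_ :&: _]setIC cardsID.
Qed.

Lemma coef_sum_Xcard P (S : 'rV[int]_n -> {set 'I_n}) g :
  g \in bases P ->
  (forall a, a \in bases P -> S a = [set: 'I_n]%SET <-> a = g) ->
  (\sum_(a \in [set` bases P]%classic) ('X^#|S a| : {poly int}))`_n = 1.
Proof.
move=> gB SP; have finB := bases_finite P.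
have inB a : (a \in fset_set [set` bases P]%classic) = (a \in bases P).
  by rewrite in_fset_set // mem_setE.
have coefS a : a \in bases P -> ('X^#|S a|)`_n = (a == g)%:R :> int.
  move=> aB; rewrite coefXn; congr (_%:R : int); congr nat_of_bool.
  apply/eqP/eqP => [cS|/(SP _ aB) ->]; last by rewrite cardsT card_ord.
  by apply/(SP _ aB)/eqP; rewrite eqEcard subsetT cardsT card_ord -cS /=.
rewrite fsbig_finite // coef_sum (bigD1_seq g) ?inB ?fset_uniq //=.
rewrite coefS // eqxx big_seq_cond big1 ?addr0 // => a /andP[].
by rewrite inB => aB /negPf ag; rewrite coefS // ag.
Qed.

End Coefficients.

Theorem theorem14 (n : nat) (n_gt0 : (0 < n)%N) (P : polymatroid n) :
  (tutte_x1 P)`_n = 1 /\ (tutte_1y P)`_n = 1.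
Proof.
have rev_inj : injective (fun i : 'I_n => rev_ord i : nat).
  by move=> i j /val_inj/rev_ord_inj.
rewrite tutte_x1E tutte_1yE; split.
  apply: (coef_sum_Xcard (greedy_base (@ord_inj n) P)) => a aB.
  by rewrite int_act_setTP; apply: optimalP aB; apply: ord_inj.
apply: (coef_sum_Xcard (greedy_base rev_inj P)) => a aB.
by rewrite ext_act_setTP; apply: optimalP aB.
Qed.
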